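(* Let $\mathsf{JL}$ be one of the justification logics described in the context, and let $\mathcal{CS}$ be a constant specification for $\mathsf{JL}$. If a $\mathsf{JL}$-formula is provable in the tableau system $\mathsf{JL}^e_{\mathcal{CS}}+(cut)$, then it is also provable in the tableau system $\mathsf{JL}^e_{\mathcal{CS}}$.
   Context: **Language.** Justification terms are built from justification variables $x,y,z,\dots$ and justification constants $a,b,c,\dots$ using binary operations $\cdot$, $+$ and unary operations $!$, $\bar{?}$, $?$. Formulas are given by $A ::= p \mid \bot \mid \neg A \mid A\to A \mid t:A$, where $p$ ranges over a countable set $\mathcal{P}$ of propositional variables and $t$ over terms. Subterms are defined as usual. A term $t$ occurs in a formula $F$ if $t$ is a subterm of some $r$ such that $r:B$ is a subformula of $F$ for some $B$. $Sub(A)$ is the set of subformulas: $Sub(p)=\{p\}$, $Sub(\bot)=\{\bot\}$, $Sub(\neg A)=\{\neg A\}\cup Sub(A)$, $Sub(A\to B)=\{A\to B\}\cup Sub(A)\cup Sub(B)$, $Sub(t:A)=\{t:A\}\cup Sub(A)$; for a set $S$ of formulas, $Sub(S)=\bigcup_{A\in S}Sub(A)$. **Justification logics.** The basic logic $\mathsf{J}$ has axiom schemes: (Taut) all propositional tautologies; (Sum) $s:A\to(s+t):A$ and $s:A\to(t+s):A$; (jK) $s:(A\to B)\to(t:A\to(s\cdot t):B)$. $\mathsf{JL}$ denotes any logic obtained from $\mathsf{J}$ by adding any combination (possibly none) of: (jT) $t:A\to A$; (jD) $t:\bot\to\bot$; (j4) $t:A\to\,!t:t:A$; (jB) $\neg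 A\to\bar{?}t:\neg t:A$; (j5) $\neg t:A\to\,?t:\neg t:A$. The language of $\mathsf{JL}$ includes only those term operations present in its axioms; its formulas are called $\mathsf{JL}$-formulas. **Constant specification.** A constant specification $\mathcal{CS}$ for $\mathsf{JL}$ is a set of formulas $c_{i_n}:c_{i_{n-1}}:\dots:c_{i_1}:A$, with $n\ge1$, the $c_{i_j}$ justification constants and $A$ an axiom instance of $\mathsf{JL}$, which is downward closed: if $c_{i_n}:c_{i_{n-1}}:\dots:c_{i_1}:A\in\mathcal{CS}$ with $n\ge2$, then $c_{i_{n-1}}:\dots:c_{i_1}:A\in\mathcal{CS}$. **Tableaux.** $A$ is a $\mathcal{CS}$-subformula of $B$ if $A\in Sub(\{B\}\cup\mathcal{CS})$. Tableaux use $\mathsf{JL}$-formulas and evidential formulas $[t,A]$ and $\sim[t,A]$, where $t$ is a term and $A$ a $\mathsf{JL}$-formula. A $\mathsf{JL}^e_{\mathcal{CS}}$-tableau for a formula $F$ is a binary tree with root $\neg F$ built by extending branches with the following rules (premises must be on the branch; ''$\mid$'' means the branch splits): - $(F\neg)$: from $\neg\neg A$ add $A$. $(F\to)$: from $\neg(A\to B)$ add $A$ and $\neg B$. $(T\to)$: from $A\to B$ split $\neg A\mid B$. - $(Te)$: from $t:A$ add $[t,A]$. $(Fe)$: from $\neg t:A$ add $\sim[t,A]$. - $(+_L)$: from $\sim[t+s,A]$ add $\sim[t,A]$. $(+_R)$: from $\sim[t+s,A]$ add $\sim[s,A]$. - $(\cdot)$: from $[s,A\to B]$ and $[t,A]$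 add $[s\cdot t,B]$, provided $A\to B$ is a $\mathcal{CS}$-subformula of the root and $s\cdot t$ occurs in the root. - $(PB)$: split $A\mid\neg A$, provided $A$ is a $\mathcal{CS}$-subformula of the root. - $(PB_e)$: split $[t,A]\mid\sim[t,A]$, provided $A$ is a $\mathcal{CS}$-subformula of the root and $t$ occurs in the root. - If $\mathsf{JL}$ contains jT, $(e)$: from $[t,A]$ add $A$. If jD, $(e_\bot)$: from $[t,\bot]$ add $\bot$. If j4, $(!)$: from $\sim[!t,t:A]$ add $\sim[t,A]$. If jB, $(\bar{?})$: from $\sim[\bar{?}t,\neg t:A]$ add $A$. If j5, $(?)$: from $\sim[?t,\neg t:A]$ add $[t,A]$. A branch closes if it contains $A$ and $\neg A$ for some $\mathsf{JL}$-formula $A$; or $[t,A]$ and $\sim[t,A]$ for some $t,A$; or $\bot$; or $\neg c:F$ for some $c:F\in\mathcal{CS}$. A tableau closes if all its branches close. A tableau proof of $F$ is a closed tableau with root $\neg F$; $F$ is provable in a tableau system if it has a tableau proof using the rules of that system. **Cut.** $\mathsf{JL}^e_{\mathcal{CS}}+(cut)$ is the system obtained by adding the rules $(cut_f)$: split $A\mid\neg A$, and $(cut_e)$: split $[t,A]\mid\sim[t,A]$, for arbitrary $\mathsf{JL}$-formulas $A$ and terms $t$ of $\mathsf{JL}$, with no restriction; all other rules are those of $\mathsf{JL}^e_{\mathcal{CS}}$, namely $(F\neg)$, $(F\to)$, $(T\to)$, $(Te)$, $(Fe)$, $(+_L)$, $(+_R)$, $(\cdot)$, $(PB)$, $(PB_e)$,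 together with $(e)$, $(e_\bot)$, $(!)$, $(\bar{?})$, $(?)$ whenever $\mathsf{JL}$ contains jT, jD, j4, jB, j5 respectively, where $(\cdot)$, $(PB)$ and $(PB_e)$ keep their side conditions. *)

(* Defs.v *)
From HB Require Import structures.
From mathcomp Require Import all_boot.

Set Implicit Arguments.
Unset Strict Implicit.
Unset Printing Implicit Defensive.

(* Terms over justification variables JV and justification constants JC, with
   all the operations; the language of a particular logic is carved out by the
   predicates JL_term and JL_formula below. *)
Inductive term (JV JC : Type) : Type :=
| TVar of JV
| TConst of JC
| TApp of term JV JC & term JV JC
| TSum of term JV JC & term JV JC
| TBang of term JV JC
| TQbar of term JV JC
| TQues of term JV JC.

Inductive formula (PV JV JC : Type) : Type :=
| Atom of PV
| Bot
| Neg of formula PV JV JC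
| Imp of formula PV JV JC & formula PV JV JC
| Just of term JV JC & formula PV JV JC.

Arguments TVar {JV JC} _.
Arguments TConst {JV JC} _.
Arguments Atom {PV JV JC} _.
Arguments Bot {PV JV JC}.

Declare Scope jl_scope.
Delimit Scope jl_scope with JL.
Bind Scope jl_scope with term.
Bind Scope jl_scope with formula.
Notation "s '⋅' t" := (TApp s t) (at level 40, left associativity) : jl_scope.
Notation "s '⊕' t" := (TSum s t) (at level 50, left associativity) : jl_scope.
Notation "'⊥'" := Bot : jl_scope.
Notation "'¬' A" := (Neg A) (at level 55, right associativity) : jl_scope.
Notation "A '⊃' B" := (Imp A B) (at level 60, right associativity) : jl_scope.
Notation "t '∶' A" := (Just t A) (at level 54, right associativity) : jl_scope.
Local Open Scope jl_scope.

(* Countability of the syntax is inherited by encoding into generic trees. *)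
Section Encoding.
Variables (PV JV JC : Type).
Local Notation trm := (term JV JC).
Local Notation fml := (formula PV JV JC).

Fixpoint term_encode (t : trm) : GenTree.tree (JV + JC) :=
  match t with
  | TVar x => GenTree.Leaf (inl x)
  | TConst c => GenTree.Leaf (inr c)
  | TApp s t => GenTree.Node 0 [:: term_encode s; term_encode t]
  | TSum s t => GenTree.Node 1 [:: term_encode s; term_encode t]
  | TBang t => GenTree.Node 2 [:: term_encode t]
  | TQbar t => GenTree.Node 3 [:: term_encode t]
  | TQues t => GenTree.Node 4 [:: term_encode t]
  end.

Fixpoint term_decode (u : GenTree.tree (JV + JC)) : option trm :=
  match u with
  | GenTree.Leaf (inl x) => Some (TVar x)
  | GenTree.Leaf (inr c) => Some (TConst c)
  | GenTree.Node 0 [:: u; v] =>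
      obind (fun s => omap (TApp s) (term_decode v)) (term_decode u)
  | GenTree.Node 1 [:: u; v] =>
      obind (fun s => omap (TSum s) (term_decode v)) (term_decode u)
  | GenTree.Node 2 [:: u] => omap (@TBang JV JC) (term_decode u)
  | GenTree.Node 3 [:: u] => omap (@TQbar JV JC) (term_decode u)
  | GenTree.Node 4 [:: u] => omap (@TQues JV JC) (term_decode u)
  | _ => None
  end.

Lemma term_encodeK : pcancel term_encode term_decode.
Proof.
by elim=> //= [s -> t ->|s -> t ->|t ->|t ->|t ->].
Qed.

Fixpoint formula_encode (A : fml) : GenTree.tree (PV + trm) :=
  match A with
  | Atom p => GenTree.Leaf (inl p)
  | Bot => GenTree.Node 0 [::]
  | Neg A => GenTree.Node 1 [:: formula_encode A]
  | Imp A B => GenTree.Node 2 [:: formula_encode A; formula_encode B]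
  | Just t A => GenTree.Node 3 [:: GenTree.Leaf (inr t); formula_encode A]
  end.

Fixpoint formula_decode (u : GenTree.tree (PV + trm)) : option fml :=
  match u with
  | GenTree.Leaf (inl p) => Some (Atom p)
  | GenTree.Node 0 [::] => Some Bot
  | GenTree.Node 1 [:: u] => omap (@Neg PV JV JC) (formula_decode u)
  | GenTree.Node 2 [:: u; v] =>
      obind (fun A => omap (Imp A) (formula_decode v)) (formula_decode u)
  | GenTree.Node 3 [:: GenTree.Leaf (inr t); v] =>
      omap (Just t) (formula_decode v)
  | _ => None
  end.

Lemma formula_encodeK : pcancel formula_encode formula_decode.
Proof. by elim=> //= [A ->|A -> B ->|t A ->]. Qed.

End Encoding.

HB.instance Definition _ (JV JC : countType) :=
  Countable.copy (term JV JC) (pcan_type (@term_encodeK JV JC)).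
HB.instance Definition _ (PV JV JC : countType) :=
  Countable.copy (formula PV JV JC) (pcan_type (@formula_encodeK PV JV JC)).

(* A tableau node: a formula A, or an evidential formula [t, A] or ~[t, A]. *)
Inductive node (PV JV JC : Type) : Type :=
| Fm of formula PV JV JC
| Ev of term JV JC & formula PV JV JC
| NEv of term JV JC & formula PV JV JC.

Section NodeEncoding.
Variables (PV JV JC : Type).
Local Notation trm := (term JV JC).
Local Notation fml := (formula PV JV JC).

Definition node_encode (x : node PV JV JC) : fml + (trm * fml + trm * fml) :=
  match x with
  | Fm A => inl A
  | Ev t A => inr (inl (t, A))
  | NEv t A => inr (inr (t, A))
  end.

Definition node_decode (u : fml + (trm * fml + trm * fml)) : node PV JV JC :=
  match u with
  | inl A => Fm A
  | inr (inl (t, A)) => Ev t A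
  | inr (inr (t, A)) => NEv t A
  end.

Lemma node_encodeK : cancel node_encode node_decode.
Proof. by case. Qed.

End NodeEncoding.

HB.instance Definition _ (PV JV JC : countType) :=
  Countable.copy (node PV JV JC) (can_type (@node_encodeK PV JV JC)).

(* The axiom schemes added to the basic logic J. *)
Record logic : Type := Logic {
  has_jT : bool;
  has_jD : bool;
  has_j4 : bool;
  has_jB : bool;
  has_j5 : bool
}.

Section JustificationLogic.
Variables (PV JV JC : countType).
Local Notation trm := (term JV JC).
Local Notation fml := (formula PV JV JC).
Local Notation nod := (node PV JV JC).
Implicit Types (L : logic) (s t r : trm) (A B C F R : fml) (x y : nod).
Implicit Types (CS : fml -> Prop) (br : seq nod).

Fixpoint JL_term L t : bool :=
  match t with
  | TVar _ | TConst _ => true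
  | TApp s t | TSum s t => JL_term L s && JL_term L t
  | TBang t => has_j4 L && JL_term L t
  | TQbar t => has_jB L && JL_term L t
  | TQues t => has_j5 L && JL_term L t
  end.

Fixpoint JL_formula L A : bool :=
  match A with
  | Atom _ | Bot => true
  | Neg A => JL_formula L A
  | Imp A B => JL_formula L A && JL_formula L B
  | Just t A => JL_term L t && JL_formula L A
  end.

Fixpoint subterms t : seq trm :=
  t :: match t with
       | TVar _ | TConst _ => [::]
       | TApp s t | TSum s t => subterms s ++ subterms t
       | TBang t | TQbar t | TQues t => subterms t
       end.

Fixpoint Sub A : seq fml :=
  A :: match A with
       | Atom _ | Bot => [::]
       | Neg A => Sub A
       | Imp A B => Sub A ++ Sub B
       | Just _ A => Sub A
       end.

Definition occurs t F : Prop :=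
  exists r B, (r ∶ B) \in Sub F /\ t \in subterms r.

(* Propositional evaluation: formulas t : A are treated as atoms. *)
Fixpoint prop_eval (v : fml -> bool) A : bool :=
  match A with
  | Atom _ | Just _ _ => v A
  | Bot => false
  | Neg A => ~~ prop_eval v A
  | Imp A B => prop_eval v A ==> prop_eval v B
  end.

Definition tautology A : Prop := forall v : fml -> bool, prop_eval v A.

Inductive scheme L : fml -> Prop :=
| ax_taut A : tautology A -> scheme L A
| ax_sumL s t A : scheme L (s ∶ A ⊃ (s ⊕ t) ∶ A)
| ax_sumR s t A : scheme L (s ∶ A ⊃ (t ⊕ s) ∶ A)
| ax_jK s t A B : scheme L (s ∶ (A ⊃ B) ⊃ t ∶ A ⊃ (s ⋅ t) ∶ B)
| ax_jT t A : has_jT L -> scheme L (t ∶ A ⊃ A)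
| ax_jD t : has_jD L -> scheme L (t ∶ ⊥ ⊃ ⊥)
| ax_j4 t A : has_j4 L -> scheme L (t ∶ A ⊃ TBang t ∶ t ∶ A)
| ax_jB t A : has_jB L -> scheme L (¬ A ⊃ TQbar t ∶ (¬ t ∶ A))
| ax_j5 t A : has_j5 L -> scheme L (¬ t ∶ A ⊃ TQues t ∶ (¬ t ∶ A)).

Definition axiom_instance L A : Prop := JL_formula L A /\ scheme L A.

(* [:: c_n; ...; c_1] and A give c_n : ... : c_1 : A. *)
Definition iter_just (cs : seq JC) A : fml :=
  foldr (fun c B => TConst c ∶ B) A cs.

Definition constant_specification L CS : Prop :=
  (forall F, CS F ->
     exists cs A, [/\ 0 < size cs, axiom_instance L A & F = iter_just cs A]) /\
  (forall c cs A, 0 < size cs -> axiom_instance L A ->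
     CS (iter_just (c :: cs) A) -> CS (iter_just cs A)).

(* A is in Sub({B} ∪ CS). *)
Definition CS_subformula CS A B : Prop :=
  exists C, (C = B \/ CS C) /\ A \in Sub C.

(* What a rule does at the end of a branch. *)
Inductive conclusion : Type :=
| Add1 of nod
| Add2 of nod & nod
| Split of nod & nod.

(* [rule L CS R br k]: on a branch with nodes br, in a tableau with root R, the
   conclusion k may be drawn. *)
Inductive rule L CS R br : conclusion -> Prop :=
| rule_Fneg A : Fm (¬ ¬ A) \in br -> rule L CS R br (Add1 (Fm A))
| rule_Fimp A B : Fm (¬ (A ⊃ B)) \in br ->
    rule L CS R br (Add2 (Fm A) (Fm (¬ B)))
| rule_Timp A B : Fm (A ⊃ B) \in br ->
    rule L CS R br (Split (Fm (¬ A)) (Fm B))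
| rule_Te t A : Fm (t ∶ A) \in br -> rule L CS R br (Add1 (Ev t A))
| rule_Fe t A : Fm (¬ t ∶ A) \in br -> rule L CS R br (Add1 (NEv t A))
| rule_sumL t s A : NEv (t ⊕ s) A \in br -> rule L CS R br (Add1 (NEv t A))
| rule_sumR t s A : NEv (t ⊕ s) A \in br -> rule L CS R br (Add1 (NEv s A))
| rule_app s t A B : Ev s (A ⊃ B) \in br -> Ev t A \in br ->
    CS_subformula CS (A ⊃ B) R -> occurs (s ⋅ t) R ->
    rule L CS R br (Add1 (Ev (s ⋅ t) B))
| rule_PB A : CS_subformula CS A R -> rule L CS R br (Split (Fm A) (Fm (¬ A)))
| rule_PBe t A : CS_subformula CS A R -> occurs t R ->
    rule L CS R br (Split (Ev t A) (NEv t A))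
| rule_e t A : has_jT L -> Ev t A \in br -> rule L CS R br (Add1 (Fm A))
| rule_ebot t : has_jD L -> Ev t ⊥ \in br -> rule L CS R br (Add1 (Fm ⊥))
| rule_bang t A : has_j4 L -> NEv (TBang t) (t ∶ A) \in br ->
    rule L CS R br (Add1 (NEv t A))
| rule_qbar t A : has_jB L -> NEv (TQbar t) (¬ t ∶ A) \in br ->
    rule L CS R br (Add1 (Fm A))
| rule_ques t A : has_j5 L -> NEv (TQues t) (¬ t ∶ A) \in br ->
    rule L CS R br (Add1 (Ev t A)).

Inductive rule_cut L CS R br : conclusion -> Prop :=
| rule_base k : rule L CS R br k -> rule_cut L CS R br k
| rule_cutf A : JL_formula L A ->
    rule_cut L CS R br (Split (Fm A) (Fm (¬ A)))
| rule_cute t A : JL_term L t -> JL_formula L A ->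
    rule_cut L CS R br (Split (Ev t A) (NEv t A)).

(* Finite node-labelled binary trees. *)
Inductive tree : Type :=
| Leaf of nod
| Node1 of nod & tree
| Node2 of nod & tree & tree.

Fixpoint branches (T : tree) : seq (seq nod) :=
  match T with
  | Leaf x => [:: [:: x]]
  | Node1 x T => map (cons x) (branches T)
  | Node2 x T1 T2 => map (cons x) (branches T1 ++ branches T2)
  end.

Definition attach x (k : conclusion) : tree :=
  match k with
  | Add1 y => Node1 x (Leaf y)
  | Add2 y z => Node1 x (Node1 y (Leaf z))
  | Split y z => Node2 x (Leaf y) (Leaf z)
  end.

(* [extend rl br T T']: T' results from T by applying one rule of rl at the end
   of one branch, where br lists the nodes above the root of T. *)
Inductive extend (rl : seq nod -> conclusion -> Prop) :
    seq nod -> tree -> tree -> Prop :=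
| extend_leaf br x k : rl (rcons br x) k ->
    extend rl br (Leaf x) (attach x k)
| extend_node1 br x T T' : extend rl (rcons br x) T T' ->
    extend rl br (Node1 x T) (Node1 x T')
| extend_node2l br x T1 T1' T2 : extend rl (rcons br x) T1 T1' ->
    extend rl br (Node2 x T1 T2) (Node2 x T1' T2)
| extend_node2r br x T1 T2 T2' : extend rl (rcons br x) T2 T2' ->
    extend rl br (Node2 x T1 T2) (Node2 x T1 T2').

(* Tableaux for F: the root is ¬ F, which is also the R of the side
   conditions. *)
Inductive tableau (rl : fml -> seq nod -> conclusion -> Prop) F :
    tree -> Prop :=
| tableau_root : tableau rl F (Leaf (Fm (¬ F)))
| tableau_step T T' : tableau rl F T -> extend (rl (¬ F)) [::] T T' ->
    tableau rl F T'.

Definition branch_closed L CS br : Prop :=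
  [\/ exists A, [/\ JL_formula L A, Fm A \in br & Fm (¬ A) \in br],
      exists t A, Ev t A \in br /\ NEv t A \in br,
      Fm ⊥ \in br
    | exists c F, CS (TConst c ∶ F) /\ Fm (¬ TConst c ∶ F) \in br].

Definition tableau_closed L CS (T : tree) : Prop :=
  forall br, br \in branches T -> branch_closed L CS br.

Definition provable L CS F : Prop :=
  exists T, tableau (rule L CS) F T /\ tableau_closed L CS T.

Definition provable_cut L CS F : Prop :=
  exists T, tableau (rule_cut L CS) F T /\ tableau_closed L CS T.

End JustificationLogic.

(* Main.v *)
Require Import Defs.
From mathcomp Require Import all_boot.
From Stdlib Require Import Classical.

(** If [F] has no cut-free proof, then [¬ F] lies in a maximal set [G] of nodes
no finite part of which starts a closed cut-free tableau.  From [G] one reads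
off a one-world model: [t ∶ A] is true when [[t, A]] is in [G], false when
[~[t, A]] is in [G], and otherwise as often as jT and jD permit, i.e. whenever
[A] is true (for jT) and [A] is not [⊥] (for jD).  The side conditions of the
rule [(·)] make it mention only pairs that [(PB_e)] decides in [G], so the model
validates it; the other rules hold on undecided pairs by the choice of default
and on decided ones since [G] is closed under them, and cuts hold classically.
Thus every tableau with cut for [F] keeps a branch that is true in the model,
and it does not close. *)

(** * Maximal sets avoiding a monotone property of finite lists *)

Section MaximalSet.
Set Implicit Arguments.
Unset Strict Implicit.

Variables (T : countType) (P : seq T -> Prop).
Hypothesis P_mono : forall s s', {subset s <= s'} -> P s -> P s'.

Definition included (s : seq T) (G : T -> Prop) := forall x, x \in s -> G x.

Fixpoint lindenbaum (s0 : seq T) n : T -> Prop :=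
  if n is m.+1 then fun x =>
    lindenbaum s0 m x \/
    unpickle m = Some x /\
      ~ exists s, included s (lindenbaum s0 m) /\ P (x :: s)
  else fun x => x \in s0.

Lemma lindenbaum_mono s0 m n x :
  m <= n -> lindenbaum s0 m x -> lindenbaum s0 n x.
Proof.
elim: n => [|n IHn]; first by rewrite leqn0 => /eqP ->.
by rewrite leq_eqVlt => /orP[/eqP -> //|ltmn Lx]; left; apply: IHn.
Qed.

Lemma lindenbaum_consistent s0 n s :
  ~ P s0 -> included s (lindenbaum s0 n) -> ~ P s.
Proof.
move=> nP0; elim: n s => [|n IHn] s sL Ps; first exact/nP0/(P_mono sL).
case: (classic (included s (lindenbaum s0 n))) => [/IHn //|nsL].
apply: nsL => x xs; case: (sL x xs) => [//|[unx []]].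
(* An element new at this stage has code [n], hence equals [x]. So [s] without [x] lies in stage
   [n], against the condition under which [x] was added. *)
exists [seq y <- s | y != x]; split=> [y|].
  rewrite mem_filter => /andP[neyx /sL[//|[uny _]]].
  by move: uny neyx; rewrite unx => -[->]; rewrite eqxx.
by apply: P_mono Ps => y ys; rewrite inE mem_filter ys andbT orbN.
Qed.

Lemma maximal_consistent_set s0 : ~ P s0 ->
  exists G : T -> Prop,
    [/\ included s0 G, forall s, included s G -> ~ P s
      & forall x, ~ G x -> exists s, included s G /\ P (x :: s)].
Proof.
move=> nP0; exists (fun x => exists n, lindenbaum s0 n x).
split=> [x xs|s sG|x nGx]; first by exists 0.
(* A finite list meets finitely many stages, so the largest of them contains it. *)
- have [n sLn] : exists n, included s (lindenbaum s0 n).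
    elim: s sG => [|x s IHs] sG; first by exists 0.
    have [m Lm] := sG x (mem_head x s).
    have [|n Ln] := IHs; first by move=> y ys; apply: sG; rewrite inE ys orbT.
    exists (maxn m n) => y; rewrite inE => /orP[/eqP ->|ys].
      exact: lindenbaum_mono (leq_maxl m n) Lm.
    exact: lindenbaum_mono (leq_maxr m n) (Ln y ys).
  exact: lindenbaum_consistent sLn.
(* [x] is examined at stage [pickle x]; its absence from the union means that it was rejected there,
   and the reason for the rejection is the required list. *)
- have /NNPP[s [sL Ps]] :
      ~ ~ exists s, included s (lindenbaum s0 (pickle x)) /\ P (x :: s).
    by move=> nex; apply: nGx; exists (pickle x).+1; right; rewrite pickleK.
  by exists s; split=> // y /sL Ly; exists (pickle x).
Qed.

End MaximalSet.

Section CutElimination.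
Set Implicit Arguments.
Unset Strict Implicit.
Unset Printing Implicit Defensive.
Local Open Scope jl_scope.

Variables (PV JV JC : countType) (L : logic) (CS : formula PV JV JC -> Prop).
Local Notation trm := (term JV JC).
Local Notation fml := (formula PV JV JC).
Local Notation nod := (node PV JV JC).
(* all_boot reuses the names [Sub] and [Split]. *)
Local Notation Sub := Defs.Sub.
Local Notation Split := Defs.Split.
Implicit Types (s t r : trm) (A B C F R : fml) (x y z : nod) (br : seq nod).
Implicit Types (T : tree PV JV JC) (k : conclusion PV JV JC).

(** * Subterms, subformulas and the side conditions *)

Lemma subterms_refl t : t \in subterms t.
Proof. by case: t => *; rewrite inE eqxx. Qed.

Lemma subterms_trans s t r :
  s \in subterms t -> t \in subterms r -> s \in subterms r.
Proof.
move=> st; elim: r => [v|c|r1 IH1 r2 IH2|r1 IH1 r2 IH2|r1 IH1|r1 IH1|r1 IH1] /=;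
  rewrite in_cons => /orP[/eqP tE|] //; try (by move: st; rewrite tE);
  rewrite in_cons ?mem_cat.
- by case/orP=> [/IH1|/IH2] ->; rewrite ?orbT.
- by case/orP=> [/IH1|/IH2] ->; rewrite ?orbT.
- by move/IH1 ->; rewrite orbT.
- by move/IH1 ->; rewrite orbT.
- by move/IH1 ->; rewrite orbT.
Qed.

Lemma Sub_refl A : A \in Sub A.
Proof. by case: A => *; rewrite inE eqxx. Qed.

Lemma Sub_trans A B C : A \in Sub B -> B \in Sub C -> A \in Sub C.
Proof.
move=> AB; elim: C => [p||C1 IH1|C1 IH1 C2 IH2|t C1 IH1] /=;
  rewrite in_cons => /orP[/eqP BE|] //; try (by move: AB; rewrite BE);
  rewrite in_cons ?mem_cat.
- by move/IH1 ->; rewrite orbT.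
- by case/orP=> [/IH1|/IH2] ->; rewrite ?orbT.
- by move/IH1 ->; rewrite orbT.
Qed.

Lemma occurs_subterm s t R : s \in subterms t -> occurs t R -> occurs s R.
Proof.
by move=> st [r [B [rR tr]]]; exists r, B; split=> //; apply: subterms_trans tr.
Qed.

Lemma CS_subformula_Sub A B R :
  A \in Sub B -> CS_subformula CS B R -> CS_subformula CS A R.
Proof.
by move=> AB [C [CR BC]]; exists C; split=> //; apply: Sub_trans BC.
Qed.

(** * Closability of a branch *)

Definition added k : seq (seq nod) :=
  match k with
  | Add1 y => [:: [:: y]]
  | Add2 y z => [:: [:: y; z]]
  | Split y z => [:: [:: y]; [:: z]]
  end.

(** Closed tableaux recast without trees. Only membership in [br] matters, so closability survives
    the addition of nodes, as the construction of a maximal set demands. *)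
Inductive closable R br : Prop :=
| closable_closed : branch_closed L CS br -> closable R br
| closable_rule k : rule L CS R br k ->
    (forall new, new \in added k -> closable R (new ++ br)) -> closable R br.

Lemma branch_closed_mono br br' :
  {subset br <= br'} -> branch_closed L CS br -> branch_closed L CS br'.
Proof.
move=> sub [[A [JA AT AF]]|[t [A [AT AF]]]|AF|[c [F [cF AF]]]].
- by apply: Or41; exists A; split=> //; apply: sub.
- by apply: Or42; exists t, A; split; apply: sub.
- by apply: Or43; apply: sub.
- by apply: Or44; exists c, F; split=> //; apply: sub.
Qed.

Lemma rule_mono R br br' k :
  {subset br <= br'} -> rule L CS R br k -> rule L CS R br' k.
Proof.
move=> sub; case=> *; by [econstructor; eauto].
Qed.

Lemma closable_mono R br br' :
  {subset br <= br'} -> closable R br -> closable R br'.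
Proof.
move=> sub cl; elim: cl br' sub => {br} [br clo|br k rk _ IH] br' sub.
  exact/closable_closed/(branch_closed_mono sub).
apply: (closable_rule (rule_mono sub rk)) => new kn; apply: (IH new kn) => x.
by rewrite !mem_cat => /orP[-> //|/sub ->]; rewrite orbT.
Qed.

(** * From closability to a closed tableau tree *)

Inductive extends (rl : seq nod -> conclusion PV JV JC -> Prop) br T :
    tree PV JV JC -> Prop :=
| extends_refl : extends rl br T T
| extends_step T1 T2 :
    extends rl br T T1 -> extend rl br T1 T2 -> extends rl br T T2.

Lemma extends_trans rl br T1 T2 T3 :
  extends rl br T1 T2 -> extends rl br T2 T3 -> extends rl br T1 T3.
Proof. by move=> e12; elim=> [//|T T' _ IH /(extends_step IH)]. Qed.

Lemma extends_node1 rl br x T T' :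
  extends rl (rcons br x) T T' -> extends rl br (Node1 x T) (Node1 x T').
Proof.
elim=> [|T1 T2 _ IH e12]; first exact: extends_refl.
exact/(extends_step IH)/extend_node1.
Qed.

Lemma extends_node2 rl br x T1 T1' T2 T2' :
  extends rl (rcons br x) T1 T1' -> extends rl (rcons br x) T2 T2' ->
  extends rl br (Node2 x T1 T2) (Node2 x T1' T2').
Proof.
move=> e1; elim=> [|T T' _ IH e2]; last exact/(extends_step IH)/extend_node2r.
elim: e1 => [|T T' _ IH e1]; first exact: extends_refl.
exact/(extends_step IH)/extend_node2l.
Qed.

Definition closed_below br T :=
  forall b, b \in branches T -> branch_closed L CS (br ++ b).

Lemma closed_below_node1 br x T :
  closed_below (rcons br x) T -> closed_below br (Node1 x T).
Proof. by move=> cT _ /mapP[b bT ->]; rewrite -cat_rcons; apply: cT. Qed.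

Lemma closed_below_node2 br x T1 T2 :
  closed_below (rcons br x) T1 -> closed_below (rcons br x) T2 ->
  closed_below br (Node2 x T1 T2).
Proof.
move=> c1 c2 _ /mapP[b + ->]; rewrite mem_cat -cat_rcons.
by case/orP=> [/c1|/c2].
Qed.

(** By induction on closability, the rule is applied at the leaf and the new leaves are grown
    further. Inclusion of [br0] in the path suffices and is what the induction preserves:
    closability puts new nodes in front, a tree path at the end. *)
Lemma closable_extends R br0 br x :
  closable R br0 -> {subset br0 <= rcons br x} ->
  exists T, extends (rule L CS R) br (Leaf x) T /\ closed_below br T.
Proof.
move=> cl; elim: cl br x => {br0} [br0 clo|br0 k rk _ IH] br x sub.
  exists (Leaf x); split=> [|b]; first exact: extends_refl.
  by rewrite inE => /eqP ->; rewrite cats1; apply: branch_closed_mono clo.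
have e1 : extends (rule L CS R) br (Leaf x) (attach x k).
  apply: extends_step (extends_refl _ _ _) _.
  exact/extend_leaf/(rule_mono sub).
have sub1 y : {subset [:: y] ++ br0 <= rcons (rcons br x) y}.
  by move=> w; rewrite mem_rcons !inE => /orP[->|/sub ->]; rewrite ?orbT.
case: k {rk} IH e1 => [y|y z|y z] IH e1.
- have [|T [eT cT]] := IH [:: y] _ _ y (sub1 y); first exact: mem_head.
  exists (Node1 x T); split; last exact: closed_below_node1.
  exact/(extends_trans e1)/extends_node1.
- have [||T [eT cT]] := IH [:: y; z] _ (rcons (rcons br x) y) z.
  + exact: mem_head.
  + move=> w; rewrite mem_cat mem_rcons in_cons mem_rcons !inE -orbA.
    case/or3P=> [->|->|]; rewrite ?orbT // => /sub.
    by rewrite mem_rcons inE => ->; rewrite !orbT.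
  exists (Node1 x (Node1 y T)); split; last by do 2!apply: closed_below_node1.
  by apply: (extends_trans e1); do 2!apply: extends_node1.
- have [|T1 [eT1 cT1]] := IH [:: y] _ _ y (sub1 y); first exact: mem_head.
  have [|T2 [eT2 cT2]] := IH [:: z] _ _ z (sub1 z); first by rewrite !inE eqxx orbT.
  exists (Node2 x T1 T2); split; last exact: closed_below_node2.
  exact/(extends_trans e1)/extends_node2.
Qed.

Lemma closable_provable F : closable (¬ F) [:: Fm (¬ F)] -> provable L CS F.
Proof.
move=> cl; have [|T [eT cT]] := @closable_extends _ _ [::] (Fm (¬ F)) cl.
  by [].
exists T; split=> //; elim: eT => [|T1 T2 _ IH]; first exact: tableau_root.
exact: tableau_step.
Qed.

(** * Saturation of the maximal set *)

Section Model.
Variables (R : fml) (G : nod -> Prop).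
Hypothesis G_consistent : forall br, included br G -> ~ closable R br.
Hypothesis G_maximal :
  forall x, ~ G x -> exists br, included br G /\ closable R (x :: br).

Lemma included1 x : G x -> included [:: x] G.
Proof. by move=> Gx y; rewrite inE => /eqP ->. Qed.

Lemma included2 x y : G x -> G y -> included [:: x; y] G.
Proof. by move=> Gx Gy z; rewrite !inE => /orP[] /eqP ->. Qed.

Lemma included_cat br br' :
  included br G -> included br' G -> included (br ++ br') G.
Proof. by move=> b b' x; rewrite mem_cat => /orP[/b|/b']. Qed.

(** Otherwise each alternative has a node outside [G], which by maximality is closable over a finite
    part of [G]; the rule then closes the union of these parts with [br], against consistency. *)
Lemma G_rule br k : included br G -> rule L CS R br k ->
  exists2 new, new \in added k & included new G.
Proof.
move=> brG rk; apply: NNPP => nex.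
have cl new : new \in added k ->
    exists br', included br' G /\ closable R (new ++ br').
  move=> kn; have [x xnG] : exists x, ~ (x \in new -> G x).
    by apply: not_all_ex_not => nG; apply: nex; exists new.
  have [xn nGx] := imply_to_and _ _ xnG.
  have [br' [br'G clx]] := G_maximal nGx; exists br'; split=> //.
  apply: closable_mono clx => y; rewrite inE mem_cat.
  by case/orP=> [/eqP ->|->]; rewrite ?xn ?orbT.
(* By monotonicity the concatenation of the separate finite parts serves all alternatives at
   once. *)
have [br' [br'G cl']] : exists br', included br' G /\
    forall new, new \in added k -> closable R (new ++ br').
  elim: (added k) cl => [|n ns IH] cl; first by exists [::].
  have [b1 [b1G cl1]] := cl n (mem_head n ns).
  have [new nns|b2 [b2G cl2]] := IH; first by apply: cl; rewrite inE nns orbT.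
  exists (b1 ++ b2); split=> [|new]; first exact: included_cat.
  rewrite inE => /orP[/eqP ->|/cl2].
    by apply: closable_mono cl1 => y; rewrite !mem_cat orbA => ->.
  by apply: closable_mono => y; rewrite !mem_cat => /orP[] ->; rewrite ?orbT.
apply: (G_consistent (included_cat brG br'G)); apply: (@closable_rule _ _ k).
  by apply: rule_mono rk => y; rewrite mem_cat => ->.
move=> new /cl'; apply: closable_mono => y.
by rewrite !mem_cat => /orP[] ->; rewrite ?orbT.
Qed.

Lemma G_add1 br y : included br G -> rule L CS R br (Add1 y) -> G y.
Proof.
by move=> brG /(G_rule brG)[new]; rewrite inE => /eqP -> nG; apply/nG/mem_head.
Qed.

Lemma G_add2 br y z :
  included br G -> rule L CS R br (Add2 y z) -> G y /\ G z.
Proof.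
move=> brG /(G_rule brG)[new]; rewrite inE => /eqP -> nG.
by split; apply: nG; rewrite !inE eqxx ?orbT.
Qed.

Lemma G_split br y z :
  included br G -> rule L CS R br (Split y z) -> G y \/ G z.
Proof.
move=> brG /(G_rule brG)[new]; rewrite !inE => /orP[] /eqP -> nG.
  by left; apply: nG; rewrite mem_head.
by right; apply: nG; rewrite mem_head.
Qed.

Lemma G_open br : included br G -> ~ branch_closed L CS br.
Proof. by move=> brG /(closable_closed R) /(G_consistent brG). Qed.

Lemma G_Ev_NEv t A : G (Ev t A) -> ~ G (NEv t A).
Proof.
move=> GE GN; apply: (G_open (included2 GE GN)); apply: Or42; exists t, A.
by rewrite !inE !eqxx orbT.
Qed.

Lemma G_nBot : ~ G (Fm ⊥).
Proof. by move=> /included1/G_open[]; apply: Or43; rewrite inE eqxx. Qed.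

(** * The one-world model *)

Definition evidence (truth_A : Prop) t A : Prop :=
  G (Ev t A) \/
  [/\ ~ G (NEv t A), has_jT L -> truth_A & has_jD L -> A <> ⊥].

(** [evidence] receives the value of [A] as a parameter, which keeps this recursion structural. *)
Fixpoint truth A : Prop :=
  match A with
  | Atom p => G (Fm (Atom p))
  | Bot => False
  | Neg A => ~ truth A
  | Imp A B => truth A -> truth B
  | Just t A => evidence (truth A) t A
  end.

(** Giving evidential formulas the value of [t ∶ A] makes (Te) and (Fe) preserve truth at once. *)
Definition node_true x : Prop :=
  match x with
  | Fm A => truth A
  | Ev t A => truth (t ∶ A)
  | NEv t A => ~ truth (t ∶ A)
  end.

Lemma NEv_false t A : G (NEv t A) -> ~ truth (t ∶ A).
Proof. by move=> GN [/G_Ev_NEv|[]]. Qed.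

(** Two implications and no equivalence, since [G] may contain neither [A] nor [¬ A]. Each case
    unfolds a node of [G] by the rule for its outermost connective. *)
Lemma truth_lemma A :
  (G (Fm A) -> truth A) /\ (G (Fm (¬ A)) -> ~ truth A).
Proof.
elim: A => [p||A [IHT IHF]|A [IAT IAF] B [IBT IBF]|t A [IHT IHF]] /=.
(* Closure by [A] and [¬ A] asks for a [JL_formula]; it is invoked here for an atom, where this is
   immediate. *)
- split=> // GF GT; apply: (G_open (included2 GT GF)); apply: Or41.
  by exists (Atom p); rewrite !inE !eqxx orbT.
- by split=> [/G_nBot //|_ []].
- split=> // GNN; suff GA : G (Fm A) by move=> nA; apply: nA; apply: IHT.
  by apply: (G_add1 (included1 GNN)); apply: rule_Fneg (mem_head _ _).
- split=> [GI|GNI].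
    have [/IAF nA /nA //|/IBT //] : G (Fm (¬ A)) \/ G (Fm B).
    by apply: (G_split (included1 GI)); apply: rule_Timp (mem_head _ _).
  have [/IAT TA /IBF nB AB] : G (Fm A) /\ G (Fm (¬ B)); last exact/nB/AB.
  by apply: (G_add2 (included1 GNI)); apply: rule_Fimp (mem_head _ _).
- split=> [GJ|GNJ].
    by left; apply: (G_add1 (included1 GJ)); apply: rule_Te (mem_head _ _).
  apply: NEv_false.
  by apply: (G_add1 (included1 GNJ)); apply: rule_Fe (mem_head _ _).
Qed.

Lemma truth_jT t A : has_jT L -> truth (t ∶ A) -> truth A.
Proof.
move=> jT [GE|[_ + _]]; last exact.
apply: (truth_lemma A).1.
by apply: (G_add1 (included1 GE)); apply: rule_e jT (mem_head _ _).
Qed.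

Lemma truth_jD t : has_jD L -> ~ truth (t ∶ ⊥).
Proof.
move=> jD [GE|[_ _ /(_ jD)//]]; apply: G_nBot.
by apply: (G_add1 (included1 GE)); apply: rule_ebot jD (mem_head _ _).
Qed.

Lemma truth_default t A :
  ~ G (NEv t A) -> (has_jT L -> truth A) -> (has_jD L -> A <> ⊥) ->
  truth (t ∶ A).
Proof. by right. Qed.

(** If [s ∶ A] is true, [NEv s A] is not in [G], hence neither is [NEv r A]; what the default
    further asks of [A] under jT and jD follows from the truth of [s ∶ A]. Both sum rules are
    instances. *)
Lemma truth_sum s r A :
  (G (NEv r A) -> G (NEv s A)) -> truth (s ∶ A) -> truth (r ∶ A).
Proof.
move=> rs sA; apply: truth_default => [/rs/NEv_false //|jT|jD AE].
  exact: truth_jT sA.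
by move: sA; rewrite AE; apply: truth_jD.
Qed.

(** (PB) applies to every member of [CS], and its negative side closes. *)
Lemma G_CS c A : CS (TConst c ∶ A) -> G (Fm (TConst c ∶ A)).
Proof.
move=> cA; have iN : included [::] G by [].
have [//|GN] : G (Fm (TConst c ∶ A)) \/ G (Fm (¬ TConst c ∶ A)).
  apply: (G_split iN); apply: rule_PB; exists (TConst c ∶ A).
  by split; [right | apply: Sub_refl].
case: (G_open (included1 GN)); apply: Or44; exists c, A.
by rewrite inE eqxx.
Qed.

(** Here (PB_e) decides the pair in [G], so its truth cannot come from the default alone. *)
Lemma Ev_of_truth t A :
  CS_subformula CS A R -> occurs t R -> truth (t ∶ A) -> G (Ev t A).
Proof.
move=> AS tR tA; have iN : included [::] G by [].
by have [//|/NEv_false] := G_split iN (rule_PBe L [::] AS tR).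
Qed.

(** * Soundness of the rules and of cut in the model *)

Definition all_true br := forall x, x \in br -> node_true x.

Lemma true_split y z : node_true y \/ node_true z ->
  exists2 new, new \in added (Split y z) & all_true new.
Proof.
by case=> Ty; [exists [:: y] | exists [:: z]];
  rewrite ?inE ?eqxx ?orbT // => x; rewrite inE => /eqP ->.
Qed.

Lemma truth_rule br k : rule L CS R br k -> all_true br ->
  exists2 new, new \in added k & all_true new.
Proof.
have one y : node_true y ->
    exists2 new, new \in added (Add1 y) & all_true new.
  by move=> Ty; exists [:: y]; rewrite ?mem_head // => x; rewrite inE => /eqP ->.
case.
- by move=> A inA /(_ _ inA) /NNPP TA; apply: one.
- move=> A B inA /(_ _ inA) /= nAB; have [TA TB] := imply_to_and _ _ nAB.
  exists [:: Fm A; Fm (¬ B)]; first exact: mem_head.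
  by move=> x; rewrite !inE => /orP[] /eqP ->.
- move=> A B inA /(_ _ inA) /= AB; apply: true_split => /=.
  by case: (classic (truth A)) => TA; [right; apply: AB | left].
- by move=> t A inA /(_ _ inA) TA; apply: one.
- by move=> t A inA /(_ _ inA) TA; apply: one.
- move=> t s A inA /(_ _ inA) nT; apply: one => TA; apply: nT.
  move: TA; apply: truth_sum => GN.
  by apply: (G_add1 (included1 GN)); apply: rule_sumL (mem_head _ _).
- move=> t s A inA /(_ _ inA) nT; apply: one => TA; apply: nT.
  move: TA; apply: truth_sum => GN.
  by apply: (G_add1 (included1 GN)); apply: rule_sumR (mem_head _ _).
- move=> s t A B inAB inA ABS stR Tbr; apply: one; left.
  (* The side conditions of (·) pass to both premises: [s] and [t] are subterms of [s ⋅ t], and [A]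
     is a subformula of [A ⊃ B]. *)
  have [sR tR] : occurs s R /\ occurs t R.
    by split; apply: occurs_subterm stR; rewrite /= inE mem_cat subterms_refl ?orbT.
  have AS : CS_subformula CS A R.
    by apply: CS_subformula_Sub ABS; rewrite /= inE mem_cat Sub_refl ?orbT.
  have GAB := Ev_of_truth ABS sR (Tbr _ inAB).
  have GA := Ev_of_truth AS tR (Tbr _ inA).
  apply: (G_add1 (included2 GAB GA)).
  by apply: rule_app ABS stR; rewrite !inE eqxx ?orbT.
- by move=> A _ _; apply/true_split/classic.
- by move=> t A _ _ _; apply/true_split/classic.
- by move=> t A jT inA /(_ _ inA) /(truth_jT jT) TA; apply: one.
- by move=> t jD inA /(_ _ inA) /(truth_jD jD).
- move=> t A j4 inA /(_ _ inA) nT; apply: one => TA; apply: nT.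
  (* The justified formula [t ∶ A] is true and is not [⊥], so the default can fail only through
     [G]. *)
  apply: truth_default => // GN; apply: NEv_false TA.
  by apply: (G_add1 (included1 GN)); apply: rule_bang j4 (mem_head _ _).
- move=> t A jB inA /(_ _ inA) nT; apply: one; apply: NNPP => nA; apply: nT.
  (* Under jT the default also needs [¬ t ∶ A] to be true; it is, since [t ∶ A] would make [A]
     true. *)
  apply: truth_default => [GN|jT /(truth_jT jT) //|//]; apply: nA.
  apply: (truth_lemma A).1; apply: (G_add1 (included1 GN)).
  by apply: rule_qbar jB (mem_head _ _).
- move=> t A j5 inA /(_ _ inA) nT; apply: one; apply: NNPP => nA; apply: nT.
  apply: truth_default => // GN; apply: nA; left.
  by apply: (G_add1 (included1 GN)); apply: rule_ques j5 (mem_head _ _).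
Qed.

Lemma truth_rule_cut br k : rule_cut L CS R br k -> all_true br ->
  exists2 new, new \in added k & all_true new.
Proof.
case=> [k' /truth_rule //|A _ _|t A _ _ _]; exact/true_split/classic.
Qed.

Lemma true_branch_open br : all_true br -> ~ branch_closed L CS br.
Proof.
move=> Tbr [[A [_ /Tbr TA /Tbr]]|[t [A [/Tbr TA /Tbr]]]|/Tbr|] //.
by case=> c [A [/G_CS /(truth_lemma _).1 TA /Tbr]].
Qed.

(** * A true branch in every tableau with cut *)

Definition has_true_branch br T :=
  exists2 b, b \in branches T & all_true (br ++ b).

Lemma has_true_branch_node1 br x T :
  has_true_branch br (Node1 x T) <-> has_true_branch (rcons br x) T.
Proof.
split=> [[_ /mapP[b bT ->]]|[b bT]]; rewrite -?cat_rcons => Tb; first by exists b.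
by exists (x :: b); [apply: map_f | rewrite -cat_rcons].
Qed.

Lemma has_true_branch_node2 br x T1 T2 :
  has_true_branch br (Node2 x T1 T2) <->
  has_true_branch (rcons br x) T1 \/ has_true_branch (rcons br x) T2.
Proof.
split=> [[_ /mapP[b + ->]]|].
  by rewrite mem_cat -cat_rcons => /orP[] bT Tb; [left | right]; exists b.
case=> -[b bT Tb]; exists (x :: b); rewrite -?cat_rcons //;
  by apply: map_f; rewrite mem_cat bT ?orbT.
Qed.

Lemma has_true_branch_leaf br x :
  has_true_branch br (Leaf x) <-> all_true (rcons br x).
Proof.
split=> [[b]|Tb]; first by rewrite inE => /eqP ->; rewrite cats1.
by exists [:: x]; rewrite ?cats1 // inE.
Qed.

Lemma all_true_rcons br x :
  all_true br -> node_true x -> all_true (rcons br x).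
Proof. by move=> Tb Tx y; rewrite mem_rcons inE => /orP[/eqP ->|/Tb]. Qed.

Lemma extend_true_branch br T T' :
  extend (rule_cut L CS R) br T T' ->
  has_true_branch br T -> has_true_branch br T'.
Proof.
elim=> {br T T'} [br x k rk|br x T T' _ IH|br x T T' T2 _ IH|br x T1 T T' _ IH].
- move=> /has_true_branch_leaf Tb; have [new] := truth_rule_cut rk Tb.
  case: k {rk} => [y|y z|y z] /=; rewrite !inE.
  + move=> /eqP -> Tn; apply/has_true_branch_node1/has_true_branch_leaf.
    by apply: all_true_rcons => //; apply: Tn; rewrite mem_head.
  + move=> /eqP -> Tn.
    apply/has_true_branch_node1/has_true_branch_node1/has_true_branch_leaf.
    have [Ty Tz] : node_true y /\ node_true z.
      by split; apply: Tn; rewrite !inE eqxx ?orbT.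
    exact: all_true_rcons (all_true_rcons Tb Ty) Tz.
  + case/orP=> /eqP -> Tn; apply/has_true_branch_node2; [left | right];
    by apply/has_true_branch_leaf/all_true_rcons => //; apply: Tn; rewrite mem_head.
- by move=> /has_true_branch_node1/IH Tb; apply/has_true_branch_node1.
- move=> /has_true_branch_node2 Tb; apply/has_true_branch_node2.
  by case: Tb => [/IH|]; [left | right].
- move=> /has_true_branch_node2 Tb; apply/has_true_branch_node2.
  by case: Tb => [|/IH]; [left | right].
Qed.

End Model.

Lemma provable_cut_closable F :
  provable_cut L CS F -> closable (¬ F) [:: Fm (¬ F)].
Proof.
case=> T [tT cT]; apply: NNPP => ncl.
(* The monotone property avoided is closability, which the root alone lacks by assumption. *)
have [G [GF Gcons Gmax]] :=
  maximal_consistent_set (@closable_mono (¬ F)) ncl.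
have [b /cT cb Tb] : has_true_branch G [::] T.
  elim: tT {cT} => [|T1 T2 _ IH e12]; last exact: extend_true_branch e12 IH.
  apply/has_true_branch_leaf => x; rewrite inE => /eqP ->.
  by apply: (truth_lemma Gcons Gmax _).1; apply: GF; rewrite mem_head.
exact: (true_branch_open Gcons Gmax Tb).
Qed.

End CutElimination.

Theorem theorem3p3 (PV JV JC : countType) (L : logic)
    (CS : formula PV JV JC -> Prop) (F : formula PV JV JC) :
  constant_specification L CS -> JL_formula L F ->
  provable_cut L CS F -> provable L CS F.
Proof. by move=> _ _ /provable_cut_closable/closable_provable. Qed.
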